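(* Let $\mathcal P$ and $\mathcal Q$ be link-preserving properties of simplicial complexes such that every complex satisfying $\mathcal P$ satisfies $\mathcal Q$, and let $d\ge0$. If the set of strong obstructions to $\mathcal P$ of dimension at most $d$ equals the set of strong obstructions to $\mathcal Q$ of dimension at most $d$, then the set of obstructions to $\mathcal P$ of dimension at most $d$ equals the set of obstructions to $\mathcal Q$ of dimension at most $d$.
   Context: A simplicial complex is a family of subsets of a finite set closed under taking subsets, with vertex set $V(\Gamma)$; for $W\subseteq V(\Gamma)$, $\Gamma[W]$ is the subcomplex of faces contained in $W$; $\mathrm{link}_\Gamma(\tau)=\{\eta\in\Gamma:\eta\cap\tau=\emptyset,\eta\cup\tau\in\Gamma\}$. A property $\mathcal P$ is link-preserving if whenever $\Gamma$ satisfies $\mathcal P$, $\mathrm{link}_\Gamma(\tau)$ satisfies $\mathcal P$ for all $\tau\in\Gamma$. $\Gamma$ is an obstruction to $\mathcal P$ if it does not satisfy $\mathcal P$ but $\Gamma[W]$ satisfies $\mathcal P$ for all $W\subsetneq V(\Gamma)$. $\Gamma$ is a strong obstruction to $\mathcal P$ if it does not satisfy $\mathcal P$ but $\mathrm{link}_{\Gamma[W]}(\tau)$ satisfies $\mathcal P$ for every $W\subseteq V(\Gamma)$ and $\tau\in\Gamma[W]$ except $W=V(\Gamma)$, $\tau=\emptyset$. *)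

(* Defs.v *)
From HB Require Import structures.
From mathcomp Require Import all_boot all_order all_algebra.

Set Implicit Arguments.
Unset Strict Implicit.
Unset Printing Implicit Defensive.

Import Order.TTheory GRing.Theory Num.Theory.
Local Open Scope ring_scope.

(* Closure is a boolean so that a complex is determined by its set of faces,
   without any proof-irrelevance axiom. *)
Definition down_closed (T : finType) (F : {set {set T}}) : bool :=
  [forall A in F, forall B : {set T}, (B \subset A) ==> (B \in F)].

(* The elements of T need not all be vertices, and the empty family (without
   even the empty face) is allowed. *)
Record complex (T : finType) := Complex {
  faces :> {set {set T}};
  _ : down_closed faces
}.

HB.instance Definition _ (T : finType) := [isSub for @faces T].

Lemma down_closedP (T : finType) (F : {set {set T}}) :
  reflect (forall A B : {set T}, A \in F -> B \subset A -> B \in F)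
          (down_closed F).
Proof.
apply: (iffP forall_inP) => [cF A B AF | cF A AF].
  by move/forallP: (cF A AF) => /(_ B) /implyP.
by apply/forallP => B; apply/implyP; apply: cF.
Qed.

Lemma faces_sub (T : finType) (K : complex T) (A B : {set T}) :
  A \in faces K -> B \subset A -> B \in faces K.
Proof. exact: (down_closedP _ (valP K)). Qed.

Definition vertices (T : finType) (K : complex T) : {set T} := cover (faces K).

Definition restr_faces (T : finType) (K : complex T) (W : {set T}) :
    {set {set T}} :=
  [set A in faces K | A \subset W].

Lemma restr_closed (T : finType) (K : complex T) (W : {set T}) :
  down_closed (restr_faces K W).
Proof.
apply/down_closedP => A B; rewrite !inE => /andP[AK AW] BA.
by rewrite (faces_sub AK BA) (subset_trans BA AW).
Qed.

Definition restr (T : finType) (K : complex T) (W : {set T}) : complex T :=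
  Complex (restr_closed K W).

Definition link_faces (T : finType) (K : complex T) (A : {set T}) :
    {set {set T}} :=
  [set B in faces K | (B :&: A == set0) && (B :|: A \in faces K)].

Lemma link_closed (T : finType) (K : complex T) (A : {set T}) :
  down_closed (link_faces K A).
Proof.
apply/down_closedP => B C; rewrite !inE => /and3P[BK BA0 BAK] CB.
rewrite (faces_sub BK CB) (faces_sub BAK (setSU _ CB)) andbT /=.
by rewrite -subset0 -(eqP BA0) setSI.
Qed.

Definition link (T : finType) (K : complex T) (A : {set T}) : complex T :=
  Complex (link_closed K A).

(* Both [set set0] and the empty family get dimension -1. *)
Definition dim (T : finType) (K : complex T) : int :=
  (\max_(A in faces K) #|A|)%N%:Z - 1.

Definition property := forall T : finType, complex T -> Prop.

Definition link_preserving (P : property) : Prop :=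
  forall (T : finType) (K : complex T), P T K ->
  forall A : {set T}, A \in faces K -> P T (link K A).

Definition obstruction (P : property) (T : finType) (K : complex T) : Prop :=
  ~ P T K /\ forall W : {set T}, W \proper vertices K -> P T (restr K W).

Definition strong_obstruction (P : property) (T : finType) (K : complex T) :
    Prop :=
  ~ P T K /\
  forall W A : {set T}, W \subset vertices K -> A \in faces (restr K W) ->
    ~ (W = vertices K /\ A = set0) -> P T (link (restr K W) A).

Definition obstruction_dim_le (P : property) (d : nat) : property :=
  fun T K => obstruction P K /\ dim K <= d%:Z.

Definition strong_obstruction_dim_le (P : property) (d : nat) : property :=
  fun T K => strong_obstruction P K /\ dim K <= d%:Z.

(* Main.v *)
(** A complex violating P yields, by passing repeatedly to proper links of
    restrictions, a strong obstruction to P of no larger dimension.  The class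
    of complexes of dimension at most d all of whose restrictions satisfy Q is
    closed under links of restrictions; a strong obstruction to P in it would
    be one to Q while satisfying Q, so all its members satisfy P.  This applies
    to the proper restrictions of an obstruction to Q, and it would apply to an
    obstruction to P satisfying Q. *)

From Stdlib Require Import Classical.
Require Import Defs.
From mathcomp Require Import all_boot all_order all_algebra.

Set Implicit Arguments.
Unset Strict Implicit.
Unset Printing Implicit Defensive.

Import Order.TTheory Num.Theory.

Section Complexes.
Variable T : finType.
Implicit Types (K L : complex T) (A U W : {set T}).

Lemma face_sub_vertices K A : A \in faces K -> A \subset vertices K.
Proof. by move=> AK; apply: bigcup_sup. Qed.

Lemma restr_vertices K W : vertices K \subset W -> restr K W = K.
Proof.
move=> VW; apply/val_inj/setP => A; rewrite inE; apply: andb_idr => AK.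
exact: subset_trans (face_sub_vertices AK) VW.
Qed.

Lemma restr_restr K U W : restr (restr K U) W = restr K (U :&: W).
Proof. by apply/val_inj/setP => A; rewrite !inE subsetI andbA. Qed.

Lemma restr_setI_vertices K W : restr K (W :&: vertices K) = restr K W.
Proof. by rewrite setIC -restr_restr (restr_vertices (subxx _)). Qed.

(** Faces of the link avoid [A], so for them lying in [U] and lying in [U :|: A] agree; adding [A]
    back keeps it a face of the smaller restriction. *)
Lemma restr_link K W A U : A \in faces (restr K W) ->
  restr (link (restr K W) A) U = link (restr K (W :&: (U :|: A))) A.
Proof.
rewrite inE => /andP[_ AW]; apply/val_inj/setP => C.
rewrite !inE !subsetI !subUset AW subsetUr !andbT /=.
have [CA0|] := boolP (C :&: A == set0); last by rewrite !andbF.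
have -> : (C \subset U :|: A) = (C \subset U).
  by rewrite setUC -subDset (setDidPl _) // -setI_eq0.
by case: (_ \in _) (_ \subset W) (_ \in _) (_ \subset U) => [] [] [] [].
Qed.

Lemma vertices_link_restr K W A :
  vertices (link (restr K W) A) \subset (vertices K :&: W) :\: A.
Proof.
apply/bigcupsP => B; rewrite !inE => /andP[/andP[BK BW] /andP[BA0 _]].
by rewrite subsetD subsetI face_sub_vertices // BW -setI_eq0.
Qed.

(** Either [W] already misses a vertex, or [A] is nonempty and its points leave the link. *)
Lemma card_vertices_link_restr K W A :
    W \subset vertices K -> A \in faces (restr K W) ->
    ~ (W = vertices K /\ A = set0) ->
  #|vertices (link (restr K W) A)| < #|vertices K|.
Proof.
rewrite inE => WV /andP[_ AW] ne; apply: proper_card.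
apply: (sub_proper_trans (vertices_link_restr K W A)).
rewrite (setIidPr WV); have [WE|nWV] := eqVneq W (vertices K); last first.
  by apply: (sub_proper_trans (subsetDl W A)); rewrite properEneq nWV.
have /set0Pn[x xA] : A != set0 by apply/eqP => A0; apply: ne.
rewrite -WE properE subsetDl; apply/subsetPn; exists x.
  exact: subsetP AW x xA.
by rewrite inE xA.
Qed.

Lemma dim_sub K L : faces L \subset faces K -> (Defs.dim L <= Defs.dim K)%R.
Proof.
move=> LK; rewrite lerD2r lez_nat; apply/bigmax_leqP => A AL.
by apply: leq_bigmax_cond; apply: subsetP AL.
Qed.

Lemma dim_restr K W : (Defs.dim (restr K W) <= Defs.dim K)%R.
Proof. by apply/dim_sub/subsetP => A; rewrite inE => /andP[]. Qed.

Lemma dim_link K A : (Defs.dim (link K A) <= Defs.dim K)%R.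
Proof. by apply/dim_sub/subsetP => B; rewrite inE => /andP[]. Qed.

(** A member of [S] violating [P] with fewest vertices would be a strong obstruction, its proper
    links of restrictions being smaller members. *)
Lemma no_strong_obstruction (P : property) (S : complex T -> Prop) :
    (forall K W A, S K -> A \in faces (restr K W) ->
       S (link (restr K W) A)) ->
    (forall K, S K -> ~ strong_obstruction P K) ->
  forall K, S K -> P T K.
Proof.
move=> Slink Snot K; have [n] := ubnP #|vertices K|.
elim: n K => // n IH K leKn SK; apply: NNPP => nPK.
apply: (Snot K SK); split=> // W A WV AK ne; apply: IH; last exact: Slink.
exact: leq_trans (card_vertices_link_restr WV AK ne) leKn.
Qed.

End Complexes.

Theorem theorem4p7 (P Q : property) (d : nat) :
  link_preserving P ->
  link_preserving Q ->
  (forall (T : finType) (K : complex T), P T K -> Q T K) ->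
  (forall (T : finType) (K : complex T),
     strong_obstruction_dim_le P d K <-> strong_obstruction_dim_le Q d K) ->
  forall (T : finType) (K : complex T),
    obstruction_dim_le P d K <-> obstruction_dim_le Q d K.
Proof.
move=> _ lQ PQ strongPQ T.
(* [Q] is required of all restrictions because it need not pass to them by itself. *)
pose S (K : complex T) := (Defs.dim K <= d%:Z)%R /\ forall W, Q T (restr K W).
have SP K : S K -> P T K.
  apply: no_strong_obstruction => {}K.
    move=> W A [dK QK] AK; split=> [|U].
      exact: le_trans (dim_link _ _) (le_trans (dim_restr _ _) dK).
    rewrite restr_link //; apply: lQ => //.
    by move: AK; rewrite !inE subsetI subsetUr andbT.
  (* A strong obstruction to [P] in [S] is one to [Q], yet [K], its own restriction to [vertices K],
     satisfies [Q]. *)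
  move=> [dK QK] sK; have [[nQK _] _] := (strongPQ T K).1 (conj sK dK).
  by apply: nQK; rewrite -(restr_vertices (subxx (vertices K))).
move=> K; split=> [] [[nK rK] dK]; split=> //; split.
- move=> QK; apply/nK/SP; split=> // W.
  (* [W] may contain non-vertices; cut down to vertices, it gives [K] itself or a proper
     restriction, where [P] and hence [Q] holds. *)
  rewrite -restr_setI_vertices.
  have [VW|nVW] := boolP (vertices K \subset W).
    by rewrite (setIidPr VW) restr_vertices.
  by apply/PQ/rK; rewrite properE subsetIr subsetI subxx andbT.
- by move=> W /rK/PQ.
- by move=> /PQ.
move=> W WV; apply: SP; split=> [|U]; first exact: le_trans (dim_restr _ _) dK.
by rewrite restr_restr; apply/rK/(sub_proper_trans (subsetIl W U)).
Qed.
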